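(* Let $A$ be a ring and let $\alpha,\beta\in\mathrm{Sper}\,A$ be such that $\langle\alpha,\beta\rangle\ne A$. Let $\mathfrak p=\sqrt{\langle\alpha,\beta\rangle}$ (a prime ideal containing the supports of $\alpha$ and $\beta$), and let $\alpha_0,\beta_0\in\mathrm{Sper}\,A_{\mathfrak p}$ be the preimages of $\alpha,\beta$ under the natural inclusion $\mathrm{Sper}\,A_{\mathfrak p}\hookrightarrow\mathrm{Sper}\,A$. If $A_{\mathfrak p}$ has the Strong Connectedness Property at $\alpha_0,\beta_0$, then for every finite collection $g_1,\dots,g_s$ of elements of $A\setminus\langle\alpha,\beta\rangle$ the points $\alpha$ and $\beta$ belong to the same connected component of $\mathrm{Sper}\,A\setminus\{g_1\cdots g_s=0\}$ (that is, $A$ satisfies the Connectedness Conjecture at $\alpha,\beta$).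
   Context: All rings are commutative with $1$. $\mathrm{Sper}\,A$ is the real spectrum with the spectral topology: a point $\alpha$ is a prime ideal $\mathfrak p_\alpha$ (the support) with a total ordering of the field of fractions $A(\alpha)$ of $A[\alpha]=A/\mathfrak p_\alpha$; $f(\alpha)$ denotes the image of $f$ in $A(\alpha)$. A specialization of $\alpha$ is a point of $\overline{\{\alpha\}}$. The separating ideal $\langle\alpha,\beta\rangle$ is the ideal of $A$ generated by all $f\in A$ with $f(\alpha)\ge0$ and $f(\beta)\le0$; such $f$ are said to change sign between $\alpha$ and $\beta$. $\nu_\alpha$ is the valuation of $A(\alpha)$ with valuation ring $\{x\in A(\alpha):|x|\le_\alpha z\text{ for some }z\in A[\alpha]\}$; for $f\in A$, $\nu_\alpha(f)=\nu_\alpha(f\bmod\mathfrak p_\alpha)$, with $\nu_\alpha(f)=\infty$ if $f\in\mathfrak p_\alpha$. For an ideal $I$, $\nu_\alpha(I)=\min_{f\in I}\nu_\alpha(f)$; thus $\nu_\alpha(g)\le\nu_\alpha(I)$ means $\nu_\alpha(g)\le\nu_\alpha(f)$ for all $f\in I$. Strong Connectedness Property: let $\Sigma$ be a ring and let $\alpha,\beta\in\mathrm{Sper}\,\Sigma$ have a common specialization. $\Sigma$ has the Strong Connectedness Property at $\alpha,\beta$ if, for any $g_1,\dots,g_s\in\Sigma\setminus(\mathfrak p_\alpha\cup\mathfrak p_\beta)$ such that for all $i$ one has $\nu_\alpha(g_i)\le\nu_\alpha(\langle\alpha,\beta\rangle)$ and $\nu_\beta(g_i)\le\nu_\beta(\langle\alpha,\beta\rangle)$,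 and such that no $g_i$ changes sign between $\alpha$ and $\beta$, the points $\alpha$ and $\beta$ belong to the same connected component of $\mathrm{Sper}\,\Sigma\setminus\{g_1\cdots g_s=0\}$. *)

(* Defs.v *)
From HB Require Import structures.
From mathcomp Require Import all_boot all_order all_algebra.
From mathcomp Require Import generic_quotient ring_quotient fraction.
From mathcomp Require Import boolp classical_sets topology.
From mathcomp Require Import zify ring.

Set Implicit Arguments.
Unset Strict Implicit.
Unset Printing Implicit Defensive.

Import Order.TTheory GRing.Theory Num.Theory.

Local Open Scope classical_set_scope.
Local Open Scope ring_scope.
Local Open Scope quotient_scope.

Definition is_prime_ideal (A : comNzRingType) (p : A -> bool) : Prop :=
  idealr_closed p /\ prime_idealr_closed p.

Section PrimePack.
Variables (A : comNzRingType) (p : A -> bool) (hp : is_prime_ideal p).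

Definition prime_pred (_ : is_prime_ideal p) : A -> bool := p.

HB.instance Definition _ := isIdealr.Build A (prime_pred hp) (proj1 hp).
HB.instance Definition _ := isPrimeIdealrClosed.Build A (prime_pred hp) (proj2 hp).

Definition prime_pack : prime_idealr A := prime_pred hp.

End PrimePack.

(* MathComp makes the quotient of a commutative ring by a prime ideal a
   nontrivial commutative ring only; [fraction] needs an [idomainType], which
   we obtain by choosing inverses classically. *)
Section PrimeQuotient.
Variables (A : comNzRingType) (p : prime_idealr A).

Definition prime_quot : Type := {ideal_quot p}.

HB.instance Definition _ := GRing.ComNzRing.on prime_quot.

Definition qproj (a : A) : prime_quot := \pi_({ideal_quot p}) a.

Lemma qproj_is_zmod_morphism : zmod_morphism qproj.
Proof. by move=> x y; rewrite /qproj rmorphB. Qed.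

Lemma qproj_is_monoid_morphism : monoid_morphism qproj.
Proof. by split=> [|x y]; rewrite /qproj ?rmorph1 ?rmorphM. Qed.

HB.instance Definition _ :=
  GRing.isZmodMorphism.Build A prime_quot qproj qproj_is_zmod_morphism.
HB.instance Definition _ :=
  GRing.isMonoidMorphism.Build A prime_quot qproj qproj_is_monoid_morphism.

Lemma qproj_eq0 (a : A) : (qproj a == 0) = (a \in p).
Proof.
rewrite -[a in RHS]subr0 Quotient.idealrBE.
by rewrite -(rmorph0 qproj).
Qed.

Lemma qproj_surj (x : prime_quot) : exists a, qproj a = x.
Proof. by exists (repr (x : {ideal_quot p})); rewrite /qproj reprK. Qed.

Definition pq_unit (x : prime_quot) : bool := `[< exists y, y * x = 1 >].

Definition pq_inv (x : prime_quot) : prime_quot :=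
  if pselect (exists y, y * x = 1) is left h then sval (cid h) else x.

Lemma pq_mulVx : {in pq_unit, left_inverse 1 pq_inv *%R}.
Proof.
move=> x /asboolP ux; rewrite /pq_inv; case: pselect => // h.
exact: (svalP (cid h)).
Qed.

Lemma pq_unitPl (x y : prime_quot) : y * x = 1 -> pq_unit x.
Proof. by move=> yx; apply/asboolP; exists y. Qed.

Lemma pq_inv_out : {in [predC pq_unit], pq_inv =1 id}.
Proof.
move=> x; rewrite inE => /asboolPn nux; rewrite /pq_inv.
by case: pselect.
Qed.

HB.instance Definition _ := GRing.ComNzRing_hasMulInverse.Build prime_quot
  pq_mulVx pq_unitPl pq_inv_out.

Lemma pq_idomain (x y : prime_quot) : x * y = 0 -> (x == 0) || (y == 0).
Proof. exact: Quotient.rquot_IdomainAxiom. Qed.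

HB.instance Definition _ :=
  GRing.ComUnitRing_isIntegral.Build prime_quot pq_idomain.

End PrimeQuotient.

Record field_order (K : fieldType) := FieldOrder {
  fo_le : K -> K -> bool;
  fo_refl : reflexive fo_le;
  fo_anti : antisymmetric fo_le;
  fo_trans : transitive fo_le;
  fo_total : total fo_le;
  fo_add : forall x y z, fo_le x y -> fo_le (x + z) (y + z);
  fo_mul : forall x y, fo_le 0 x -> fo_le 0 y -> fo_le 0 (x * y) }.

(* The support is stored as a bare predicate, and packed as a [prime_idealr] by
   [supp_ideal] below: this keeps [Sper A] in a universe small enough for the
   topological structures. *)
Record Sper (A : comNzRingType) := MkSper {
  supp : A -> bool;
  supp_prime : is_prime_ideal supp;
  sper_order : field_order {fraction prime_quot (prime_pack supp_prime)} }.

Definition supp_ideal (A : comNzRingType) (alpha : Sper A) : prime_idealr A :=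
  prime_pack (supp_prime alpha).

(* A[alpha] *)
Definition quot_at (A : comNzRingType) (alpha : Sper A) : idomainType :=
  prime_quot (supp_ideal alpha).

(* A(alpha), an ordered field for the order carried by alpha *)
Section ResidueField.
Variables (A : comNzRingType) (alpha : Sper A).

Definition res_field : Type := {fraction prime_quot (supp_ideal alpha)}.

HB.instance Definition _ := GRing.Field.on res_field.

Definition rf_le : rel res_field := fo_le (sper_order alpha).
Definition rf_lt : rel res_field := fun x y => (y != x) && rf_le x y.
Definition rf_norm (x : res_field) : res_field := if rf_le 0 x then x else - x.

Lemma rf_le0D x y : rf_le 0 x -> rf_le 0 y -> rf_le 0 (x + y).
Proof.
move=> x0 y0; apply: (fo_trans y0).
by have := fo_add y x0; rewrite add0r.
Qed.

Lemma rf_le0_anti x : rf_le 0 x -> rf_le x 0 -> x = 0.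
Proof. by move=> x0 x0'; apply: (fo_anti (f := sper_order alpha)); apply/andP. Qed.

Lemma rf_subr_ge0 x y : rf_le 0 (y - x) = rf_le x y.
Proof.
apply/idP/idP => h.
  by have := fo_add x h; rewrite add0r subrK.
by have := fo_add (- x) h; rewrite subrr.
Qed.

Lemma rf_le0_total x : rf_le 0 x || rf_le x 0.
Proof. exact: fo_total. Qed.

Lemma rf_normN x : rf_norm (- x) = rf_norm x.
Proof.
rewrite /rf_norm; have := rf_subr_ge0 x 0; rewrite sub0r => ->.
have [x0|nx0] := boolP (rf_le 0 x); have [x0'|nx0'] := boolP (rf_le x 0).
- by rewrite (rf_le0_anti x0 x0') oppr0.
- by rewrite opprK.
- by [].
- by have := rf_le0_total x; rewrite (negPf nx0) (negPf nx0').
Qed.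

Lemma rf_ge0_norm x : rf_le 0 x -> rf_norm x = x.
Proof. by rewrite /rf_norm => ->. Qed.

HB.instance Definition _ := Num.IntegralDomain_isLeReal.Build res_field
  rf_le0D (@fo_mul _ (sper_order alpha)) rf_le0_anti rf_subr_ge0 rf_le0_total
  rf_normN rf_ge0_norm (fun x y => erefl (rf_lt x y)).

(* the inclusion of A[alpha] in A(alpha) *)
Definition quot_incl (z : quot_at alpha) : res_field := FracField.tofrac z.

(* f(alpha) *)
Definition ev (f : A) : res_field := quot_incl (qproj (supp_ideal alpha) f).

Lemma ev_is_zmod_morphism : zmod_morphism ev.
Proof. by move=> x y; rewrite /ev /quot_incl !rmorphB. Qed.

Lemma ev_is_monoid_morphism : monoid_morphism ev.
Proof. by split=> [|x y]; rewrite /ev /quot_incl ?rmorph1 ?rmorphM. Qed.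

HB.instance Definition _ :=
  GRing.isZmodMorphism.Build A res_field ev ev_is_zmod_morphism.
HB.instance Definition _ :=
  GRing.isMonoidMorphism.Build A res_field ev ev_is_monoid_morphism.

Lemma ev_eq0 (f : A) : (ev f == 0) = (f \in supp alpha).
Proof. by rewrite /ev /quot_incl tofrac_eq0 qproj_eq0. Qed.

Definition val_ring : set res_field :=
  [set x | exists z : quot_at alpha, `|x| <= quot_incl z].

(* nu_alpha(g) <= nu_alpha(f); as a valuation is given by its valuation ring
   only up to equivalence, we compare values through divisibility in that ring.
   Elements of the support have value infinity. *)
Definition nu_le (g f : A) : Prop :=
  exists2 u, val_ring u & ev f = u * ev g.

End ResidueField.

Section Topology.
Variable A : comNzRingType.

HB.instance Definition _ := gen_eqMixin (Sper A).
HB.instance Definition _ := gen_choiceMixin (Sper A).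

(* the spectral topology is generated by the sets {f > 0} *)
Definition spectral_subbase : set (set (Sper A)) :=
  range (fun f : A => [set gamma : Sper A | 0 < ev gamma f]).

HB.instance Definition _ :=
  isSubBaseTopological.Build (Sper A) spectral_subbase id.

End Topology.

Section FracMap.
Variables (D E : idomainType) (f : {rmorphism D -> E}).
Hypothesis f_inj : injective f.

Definition frac_map (x : {fraction D}) : {fraction E} :=
  FracField.tofrac (f (frac (repr x)).1) / FracField.tofrac (f (frac (repr x)).2).

Lemma fracP (x : {fraction D}) : exists n d : D,
  d != 0 /\ x = FracField.tofrac n / FracField.tofrac d.
Proof.
elim/quotW: x => r; exists (frac r).1, (frac r).2; split; first exact: denom_ratioP.
have d0 : FracField.tofrac (frac r).2 != 0 by rewrite tofrac_eq0 denom_ratioP.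
apply: (mulIf d0); rewrite divfK //.
unlock FracField.tofrac; rewrite -[LHS]FracField.pi_mul; apply/eqmodP => /=.
rewrite FracField.equivfE /FracField.mulf.
rewrite !numden_Ratio ?mulr1 ?oner_neq0 ?denom_ratioP //.
by rewrite mulrC.
Qed.

Lemma tofrac_f_neq0 d : d != 0 -> FracField.tofrac (f d) != 0.
Proof. by rewrite tofrac_eq0 -(rmorph0 f) (inj_eq f_inj). Qed.

Lemma frac_mapE n d : d != 0 ->
  frac_map (FracField.tofrac n / FracField.tofrac d) =
  FracField.tofrac (f n) / FracField.tofrac (f d).
Proof.
move=> d0; rewrite /frac_map; set x := (X in repr X).
have e : x * FracField.tofrac d = FracField.tofrac n.
  by rewrite divfK // tofrac_eq0.
have {}e : (frac (repr x)).1 * d = n * (frac (repr x)).2.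
  have r0 : FracField.tofrac (frac (repr x)).2 != 0.
    by rewrite tofrac_eq0 denom_ratioP.
  have xE : x * FracField.tofrac (frac (repr x)).2 = FracField.tofrac (frac (repr x)).1.
    rewrite -{1}[x]reprK; unlock FracField.tofrac.
    rewrite -[LHS]FracField.pi_mul; apply/eqmodP => /=.
    rewrite FracField.equivfE /FracField.mulf.
    rewrite !numden_Ratio ?mulr1 ?oner_neq0 ?denom_ratioP //.
    by rewrite mulrC.
  by apply/eqP; rewrite -tofrac_eq !tofracM -e -xE mulrAC.
apply/eqP; rewrite eqr_div ?tofrac_f_neq0 ?denom_ratioP //.
by rewrite -!tofracM -!rmorphM e.
Qed.

Lemma frac_map0 : frac_map 0 = 0.
Proof.
have := frac_mapE 0 (oner_neq0 D).
by rewrite !rmorph0 !mul0r.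
Qed.

Lemma frac_mapD : {morph frac_map : x y / x + y}.
Proof.
move=> x y; have [a [b [b0 ->]]] := fracP x; have [c [d [d0 ->]]] := fracP y.
rewrite addf_div ?tofrac_eq0 // -!tofracM -tofracD.
rewrite !frac_mapE ?mulf_neq0 // addf_div ?tofrac_f_neq0 //.
by rewrite !rmorphD !rmorphM.
Qed.

Lemma frac_mapM : {morph frac_map : x y / x * y}.
Proof.
move=> x y; have [a [b [b0 ->]]] := fracP x; have [c [d [d0 ->]]] := fracP y.
rewrite mulf_div -!tofracM !frac_mapE ?mulf_neq0 // mulf_div.
by rewrite !rmorphM.
Qed.

Lemma frac_map_inj : injective frac_map.
Proof.
move=> x y; have [a [b [b0 ->]]] := fracP x; have [c [d [d0 ->]]] := fracP y.
rewrite !frac_mapE // => /eqP; rewrite eqr_div ?tofrac_f_neq0 //.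
rewrite -!tofracM -!rmorphM tofrac_eq (inj_eq f_inj) => /eqP e.
by apply/eqP; rewrite eqr_div ?tofrac_eq0 // -!tofracM e.
Qed.

End FracMap.

Section SperMap.
Variables (A B : comNzRingType) (phi : {rmorphism A -> B}).

Section Preimage.
Variable q : prime_idealr B.

Definition preim_pred (a : A) : bool := phi a \in q.

Lemma in_preim (a : A) : (a \in preim_pred) = (phi a \in q).
Proof. by []. Qed.

Lemma preim_prime : is_prime_ideal preim_pred.
Proof.
split=> [|x y]; last by rewrite !in_preim rmorphM prime_idealrM.
split=> [||a x y]; rewrite !in_preim ?rmorph0 ?rpred0 ?rmorph1 ?idealr1 //.
by move=> hx hy; rewrite rmorphD rmorphM rpredD ?idealMr.
Qed.

Definition preim_ideal : prime_idealr A := prime_pack preim_prime.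

Definition quot_map (x : prime_quot preim_ideal) : prime_quot q :=
  qproj q (phi (repr (x : {ideal_quot preim_ideal}))).

Lemma quot_mapE a : quot_map (qproj preim_ideal a) = qproj q (phi a).
Proof.
apply/eqP; rewrite -subr_eq0 /quot_map -!rmorphB qproj_eq0.
have -> : (phi (repr (qproj preim_ideal a : {ideal_quot preim_ideal}) - a) \in q) =
  (repr (qproj preim_ideal a : {ideal_quot preim_ideal}) - a \in preim_ideal) by [].
by rewrite Quotient.idealrBE reprK.
Qed.

Lemma quot_map_is_zmod_morphism : zmod_morphism quot_map.
Proof.
move=> x y; have [a <-] := qproj_surj x; have [b <-] := qproj_surj y.
by rewrite -rmorphB !quot_mapE !rmorphB.
Qed.

Lemma quot_map_is_monoid_morphism : monoid_morphism quot_map.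
Proof.
split=> [|x y]; first by rewrite -(rmorph1 (qproj _)) quot_mapE !rmorph1.
have [a <-] := qproj_surj x; have [b <-] := qproj_surj y.
by rewrite -rmorphM !quot_mapE !rmorphM.
Qed.

HB.instance Definition _ := GRing.isZmodMorphism.Build
  (prime_quot preim_ideal) (prime_quot q) quot_map quot_map_is_zmod_morphism.
HB.instance Definition _ := GRing.isMonoidMorphism.Build
  (prime_quot preim_ideal) (prime_quot q) quot_map quot_map_is_monoid_morphism.

Lemma quot_map_inj : injective quot_map.
Proof.
move=> x y; have [a <-] := qproj_surj x; have [b <-] := qproj_surj y.
rewrite !quot_mapE => /eqP; rewrite -subr_eq0 -!rmorphB qproj_eq0 => h.
by apply/eqP; rewrite -subr_eq0 -rmorphB qproj_eq0.
Qed.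

End Preimage.

Variable gamma : Sper B.

Local Notation psi := (frac_map (quot_map (q := supp_ideal gamma))).

Definition pull_le : rel {fraction prime_quot (preim_ideal (supp_ideal gamma))} :=
  fun x y => fo_le (sper_order gamma) (psi x) (psi y).

Lemma pull_refl : reflexive pull_le.
Proof. by move=> x; apply: fo_refl. Qed.

Lemma pull_anti : antisymmetric pull_le.
Proof.
by move=> x y /fo_anti; apply: frac_map_inj; apply: quot_map_inj.
Qed.

Lemma pull_trans : transitive pull_le.
Proof. by move=> y x z; apply: fo_trans. Qed.

Lemma pull_total : total pull_le.
Proof. by move=> x y; apply: fo_total. Qed.

Lemma pull_add x y z : pull_le x y -> pull_le (x + z) (y + z).
Proof.
rewrite /pull_le !(frac_mapD (@quot_map_inj (supp_ideal gamma))); exact: fo_add.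
Qed.

Lemma pull_mul x y : pull_le 0 x -> pull_le 0 y -> pull_le 0 (x * y).
Proof.
rewrite /pull_le (frac_mapM (@quot_map_inj (supp_ideal gamma))).
rewrite (frac_map0 (@quot_map_inj (supp_ideal gamma))); exact: fo_mul.
Qed.

(* the map Sper B -> Sper A induced by phi *)
Definition Sper_map : Sper A :=
  MkSper (FieldOrder pull_refl pull_anti pull_trans pull_total pull_add pull_mul).

End SperMap.

Section Localization.
Variables (A : comNzRingType) (p : prime_idealr A).

Inductive loc_pair := LocPair { loc_pair_val :> A * A; _ : loc_pair_val.2 \notin p }.

HB.instance Definition _ := [isSub for loc_pair_val].
HB.instance Definition _ := [Choice of loc_pair by <:].

Lemma loc_denP (x : loc_pair) : x.2 \notin p. Proof. by case: x. Qed.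

Lemma prime_one_notin : 1 \notin p. Proof. by rewrite idealr1. Qed.

Lemma prime_mul_notin (s t : A) : s \notin p -> t \notin p -> s * t \notin p.
Proof. by move=> hs ht; rewrite prime_idealrM negb_or hs. Qed.

Definition loc_equiv (x y : loc_pair) : bool :=
  `[< exists2 u, u \notin p & u * (x.1 * y.2 - y.1 * x.2) = 0 >].

Lemma loc_equiv_refl : reflexive loc_equiv.
Proof.
by move=> x; apply/asboolP; exists 1; rewrite ?prime_one_notin // subrr mulr0.
Qed.

Lemma loc_equiv_sym : symmetric loc_equiv.
Proof.
move=> x y; apply/asboolP/asboolP => -[u up e]; exists u => //;
by rewrite -opprB mulrN e oppr0.
Qed.

Lemma loc_equiv_trans : transitive loc_equiv.
Proof.
move=> y x z /asboolP[u up e] /asboolP[v vp e']; apply/asboolP.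
exists (u * v * y.2); first by rewrite !prime_mul_notin ?loc_denP.
transitivity (v * z.2 * (u * (x.1 * y.2 - y.1 * x.2)) +
              u * x.2 * (v * (y.1 * z.2 - z.1 * y.2))); last first.
  by rewrite e e' !mulr0 addr0.
ring.
Qed.

Canonical loc_equiv_equiv := EquivRel loc_equiv loc_equiv_refl loc_equiv_sym loc_equiv_trans.

Definition loc_type := {eq_quot loc_equiv}.

HB.instance Definition _ : EqQuotient _ loc_equiv loc_type := EqQuotient.on loc_type.
HB.instance Definition _ := Choice.on loc_type.

Definition loc_frac (a s : A) (hs : s \notin p) : loc_type :=
  \pi_loc_type (@LocPair (a, s) hs).

Lemma loc_frac_surj (x : loc_type) : exists a s (hs : s \notin p), x = loc_frac a hs.
Proof. by elim/quotW: x => -[[a s] hs]; exists a, s, hs. Qed.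

Lemma loc_fracP (a b s t : A) (hs : s \notin p) (ht : t \notin p) :
  loc_frac a hs = loc_frac b ht <->
  exists2 u, u \notin p & u * (a * t - b * s) = 0.
Proof. by split=> [/eqmodP/asboolP|h]; last exact/eqmodP/asboolP. Qed.

Definition loc_add (x y : loc_type) : loc_type :=
  loc_frac ((repr x).1 * (repr y).2 + (repr y).1 * (repr x).2)
          (prime_mul_notin (loc_denP (repr x)) (loc_denP (repr y))).
Definition loc_opp (x : loc_type) : loc_type := loc_frac (- (repr x).1) (loc_denP (repr x)).
Definition loc_mul (x y : loc_type) : loc_type :=
  loc_frac ((repr x).1 * (repr y).1) (prime_mul_notin (loc_denP (repr x)) (loc_denP (repr y))).

Lemma repr_loc_frac (a s : A) (hs : s \notin p) : exists2 u, u \notin p &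
  u * ((repr (loc_frac a hs)).1 * s) = u * (a * (repr (loc_frac a hs)).2).
Proof.
have /eqmodP/asboolP[u up e] : \pi_loc_type (repr (loc_frac a hs)) = loc_frac a hs.
  exact: reprK.
by exists u => //; apply/eqP; rewrite -subr_eq0 -mulrBr e.
Qed.

Lemma loc_addE a b s t (hs : s \notin p) (ht : t \notin p) :
  loc_add (loc_frac a hs) (loc_frac b ht) = loc_frac (a * t + b * s) (prime_mul_notin hs ht).
Proof.
rewrite /loc_add; have [u up] := repr_loc_frac a hs; have [v vp] := repr_loc_frac b ht.
case: (repr _) => -[b' t'] ht' /= eb; case: (repr _) => -[a' s'] hs' /= ea.
apply/loc_fracP; exists (u * v); first exact: prime_mul_notin.
apply/eqP; rewrite mulrBr subr_eq0; apply/eqP.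
transitivity (v * t * t' * (u * (a' * s)) + u * s * s' * (v * (b' * t))).
  ring.
transitivity (v * t * t' * (u * (a * s')) + u * s * s' * (v * (b * t'))); last by ring.
by congr (_ * _ + _ * _).
Qed.

Lemma loc_oppE a s (hs : s \notin p) : loc_opp (loc_frac a hs) = loc_frac (- a) hs.
Proof.
rewrite /loc_opp; have [u up] := repr_loc_frac a hs.
case: (repr _) => -[a' s'] hs' /= ea; apply/loc_fracP; exists u => //.
by rewrite !mulNr -opprD mulrN mulrBr ea subrr oppr0.
Qed.

Lemma loc_mulE a b s t (hs : s \notin p) (ht : t \notin p) :
  loc_mul (loc_frac a hs) (loc_frac b ht) = loc_frac (a * b) (prime_mul_notin hs ht).
Proof.
rewrite /loc_mul; have [u up] := repr_loc_frac a hs; have [v vp] := repr_loc_frac b ht.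
case: (repr _) => -[b' t'] ht' /= eb; case: (repr _) => -[a' s'] hs' /= ea.
apply/loc_fracP; exists (u * v); first exact: prime_mul_notin.
apply/eqP; rewrite mulrBr subr_eq0; apply/eqP.
transitivity ((u * (a' * s)) * (v * (b' * t))); first by ring.
by rewrite ea eb; ring.
Qed.

Lemma loc_frac_eq (a b s t : A) (hs : s \notin p) (ht : t \notin p) :
  a = b -> s = t -> loc_frac a hs = loc_frac b ht.
Proof. by move=> -> e; case: t / e ht => ht; congr loc_frac; apply: bool_irrelevance. Qed.

Lemma loc_addA : associative loc_add.
Proof.
move=> x y z; have [a [s [hs ->]]] := loc_frac_surj x.
have [b [t [ht ->]]] := loc_frac_surj y; have [c [r [hr ->]]] := loc_frac_surj z.
rewrite !loc_addE; apply: loc_frac_eq; rewrite ?mulrA //.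
ring.
Qed.

Lemma loc_addC : commutative loc_add.
Proof.
move=> x y; have [a [s [hs ->]]] := loc_frac_surj x.
have [b [t [ht ->]]] := loc_frac_surj y.
by rewrite !loc_addE; apply: loc_frac_eq; rewrite 1?addrC // mulrC.
Qed.

Lemma loc_add0x : left_id (loc_frac 0 prime_one_notin) loc_add.
Proof.
move=> x; have [a [s [hs ->]]] := loc_frac_surj x.
by rewrite loc_addE; apply: loc_frac_eq; rewrite ?mul1r // mul0r mulr1 add0r.
Qed.

Lemma loc_addNx : left_inverse (loc_frac 0 prime_one_notin) loc_opp loc_add.
Proof.
move=> x; have [a [s [hs ->]]] := loc_frac_surj x.
rewrite loc_oppE loc_addE; apply/loc_fracP; exists 1; first exact: prime_one_notin.
by rewrite mulNr addNr !mul0r subrr mulr0.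
Qed.

HB.instance Definition _ := GRing.isZmodule.Build loc_type loc_addA loc_addC loc_add0x loc_addNx.

Lemma loc_mulA : associative loc_mul.
Proof.
move=> x y z; have [a [s [hs ->]]] := loc_frac_surj x.
have [b [t [ht ->]]] := loc_frac_surj y; have [c [r [hr ->]]] := loc_frac_surj z.
by rewrite !loc_mulE; apply: loc_frac_eq; rewrite mulrA.
Qed.

Lemma loc_mulC : commutative loc_mul.
Proof.
move=> x y; have [a [s [hs ->]]] := loc_frac_surj x.
have [b [t [ht ->]]] := loc_frac_surj y.
by rewrite !loc_mulE; apply: loc_frac_eq; rewrite mulrC.
Qed.

Lemma loc_mul1x : left_id (loc_frac 1 prime_one_notin) loc_mul.
Proof.
move=> x; have [a [s [hs ->]]] := loc_frac_surj x.
by rewrite loc_mulE; apply: loc_frac_eq; rewrite mul1r.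
Qed.

Lemma loc_mulDx : left_distributive loc_mul +%R.
Proof.
move=> x y z; have [a [s [hs ->]]] := loc_frac_surj x.
have [b [t [ht ->]]] := loc_frac_surj y; have [c [r [hr ->]]] := loc_frac_surj z.
rewrite -[_ + _]/(loc_add _ _) -[RHS]/(loc_add _ _) loc_addE !loc_mulE loc_addE.
apply/loc_fracP; exists 1; first exact: prime_one_notin.
rewrite mul1r; apply/eqP; rewrite subr_eq0; apply/eqP.
ring.
Qed.

Lemma loc_oner_neq0 : loc_frac 1 prime_one_notin != 0 :> loc_type.
Proof.
apply/eqP => /loc_fracP[u up]; rewrite mul0r subr0 !mulr1 => u0.
by move: up; rewrite u0 rpred0.
Qed.

HB.instance Definition _ :=
  GRing.Zmodule_isComNzRing.Build loc_type loc_mulA loc_mulC loc_mul1x loc_mulDx loc_oner_neq0.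

End Localization.

Section LocMap.
Variables (A : comNzRingType) (p : prime_idealr A).

(* A_p *)
Definition localization : comNzRingType := loc_type p.

(* the natural map a |-> a / 1 *)
Definition loc_map (a : A) : localization :=
  loc_frac a (prime_one_notin p).

Lemma loc_map_is_zmod_morphism : zmod_morphism loc_map.
Proof.
move=> x y; rewrite -[RHS]/(loc_add _ (loc_opp _)).
rewrite loc_oppE loc_addE.
by apply: loc_frac_eq; rewrite ?mulr1.
Qed.

Lemma loc_map_is_monoid_morphism : monoid_morphism loc_map.
Proof.
split=> [|x y] //; rewrite -[RHS]/(loc_mul _ _) loc_mulE.
by apply: loc_frac_eq; rewrite ?mulr1.
Qed.

HB.instance Definition _ := GRing.isZmodMorphism.Build A localization loc_map
  loc_map_is_zmod_morphism.
HB.instance Definition _ := GRing.isMonoidMorphism.Build A localization loc_map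
  loc_map_is_monoid_morphism.

End LocMap.

Section SeparatingIdeal.
Variable A : comNzRingType.

Definition ideal_gen (S : set A) : set A :=
  [set x | exists n (a c : 'I_n -> A),
     (forall i, S (c i)) /\ x = \sum_(i < n) a i * c i].

Definition radical (I : set A) : set A := [set x | exists n, I (x ^+ n)].

Definition sep_ideal (alpha beta : Sper A) : set A :=
  ideal_gen [set f | 0 <= ev alpha f /\ ev beta f <= 0].

(* Sign changes are meant in either direction; the generators of [sep_ideal],
   which only go in one direction, generate the same ideal since it contains
   their opposites. *)
Definition changes_sign (alpha beta : Sper A) (f : A) : Prop :=
  (0 <= ev alpha f /\ ev beta f <= 0) \/ (ev alpha f <= 0 /\ 0 <= ev beta f).

Variables alpha beta : Sper A.
Local Notation I := (sep_ideal alpha beta).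

Lemma sep_ideal0 : I 0.
Proof. by exists 0%N, (fun=> 0), (fun=> 0); split=> [[]|] //; rewrite big_ord0. Qed.

Lemma sep_idealD x y : I x -> I y -> I (x + y).
Proof.
move=> [n [a [c [hc ->]]]] [m [b [d [hd ->]]]].
exists (n + m)%N, (fun i => match split i with inl j => a j | inr j => b j end).
exists (fun i => match split i with inl j => c j | inr j => d j end); split.
  by move=> i; case: split.
rewrite big_split_ord /=; congr (_ + _); apply: eq_bigr => i _.
  by rewrite (unsplitK (inl i)).
by rewrite (unsplitK (inr i)).
Qed.

Lemma sep_idealM u x : I x -> I (u * x).
Proof.
move=> [n [a [c [hc ->]]]]; exists n, (fun i => u * a i), c; split=> //.
by rewrite mulr_sumr; apply: eq_bigr => i _; rewrite mulrA.
Qed.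

Lemma sep_idealN x : I x -> I (- x).
Proof. by rewrite -mulN1r; apply: sep_idealM. Qed.

Lemma sep_ideal_sum n (F : 'I_n -> A) : (forall i, I (F i)) -> I (\sum_(i < n) F i).
Proof.
by move=> hF; apply: big_ind => //; [exact: sep_ideal0|exact: sep_idealD].
Qed.

Lemma sep_ideal_gen f : changes_sign alpha beta f -> I f.
Proof.
have h g : 0 <= ev alpha g -> ev beta g <= 0 -> I g.
  by move=> ag bg; exists 1%N, (fun=> 1), (fun=> g); rewrite big_ord1 mul1r.
case=> -[af bf]; first exact: h.
by rewrite -[f]opprK; apply/sep_idealN/h; rewrite rmorphN ?oppr_ge0 ?oppr_le0.
Qed.

Lemma sep_ideal_supp : (forall f, f \in supp alpha -> I f) /\
  (forall f, f \in supp beta -> I f).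
Proof.
split=> f; rewrite -ev_eq0 => /eqP f0; apply: sep_ideal_gen;
rewrite /changes_sign f0 lexx.
  by case: (leP 0 (ev beta f)) => [|/ltW]; [right|left].
by case: (leP 0 (ev alpha f)) => [|/ltW]; [left|right].
Qed.

Lemma sep_ideal_sign a : ~ I a ->
  (0 < ev alpha a /\ 0 < ev beta a) \/ (ev alpha a < 0 /\ ev beta a < 0).
Proof.
move=> nIa; case: (ltP 0 (ev alpha a)) => ha; case: (ltP 0 (ev beta a)) => hb.
- by left.
- by case: nIa; apply: sep_ideal_gen; left; rewrite ltW.
- by case: nIa; apply: sep_ideal_gen; right; rewrite (ltW hb).
right; rewrite !lt_neqAle ha hb !andbT; split; apply/negP; rewrite ev_eq0 => h;
by apply: nIa; case: sep_ideal_supp => h1 h2; first [exact: h1|exact: h2].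
Qed.

Hypothesis I1 : I <> setT.

Lemma sep_ideal1 : ~ I 1.
Proof.
by move=> h; apply: I1; apply/seteqP; split=> // x _;
rewrite -[x]mulr1; apply: sep_idealM.
Qed.

Definition pos2 a := 0 < ev alpha a /\ 0 < ev beta a.

Lemma notI_addl a i : ~ I a -> I i -> ~ I (a + i).
Proof.
by move=> nIa Ii h; apply: nIa; rewrite -[a](addrK i);
apply: sep_idealD => //; apply: sep_idealN.
Qed.

(* Positive elements outside I stay positive modulo I. *)
Lemma pos2_addgen a b c : ~ I a -> pos2 a ->
  0 <= ev alpha c -> ev beta c <= 0 -> pos2 (a + b * c).
Proof.
move=> nIa pa ac bc.
have Ic : I c by apply: sep_ideal_gen; left.
have key x y : ~ I x -> pos2 x -> ~ I y -> pos2 (x + y * c).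
  move=> nIx [xa xb] nIy.
  have [//|[ha hb]] := sep_ideal_sign (notI_addl nIx (sep_idealM y Ic)).
  have [[ya yb]|[ya yb]] := sep_ideal_sign nIy.
    suff : 0 < ev alpha (x + y * c) by rewrite ltNge (ltW ha).
    by rewrite rmorphD rmorphM ltr_pwDl // mulr_ge0 // ltW.
  suff : 0 < ev beta (x + y * c) by rewrite ltNge (ltW hb).
  by rewrite rmorphD rmorphM ltr_pwDl // mulr_le0 // ltW.
have [Ib|nIb] := pselect (I b); last exact: key.
have nIac : ~ I (a - c) by apply: notI_addl => //; apply: sep_idealN.
have pac : pos2 (a - c).
  have [//|[ha hb]] := sep_ideal_sign nIac.
  suff : 0 < ev beta (a - c) by rewrite ltNge (ltW hb).
  by rewrite rmorphB ltr_pwDl ?oppr_ge0 //; case: pa.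
have -> : a + b * c = (a - c) + (1 + b) * c by ring.
by apply: key => //; apply: notI_addl => //; exact: sep_ideal1.
Qed.

Lemma pos2_add a i : ~ I a -> pos2 a -> I i -> pos2 (a + i).
Proof.
move=> nIa pa [n [u [c [hc ->]]]].
elim: n u c hc => [|n IHn] u c hc; first by rewrite big_ord0 addr0.
rewrite big_ord_recr /= addrA; case: (hc ord_max) => h1 h2.
apply: pos2_addgen => //; last first.
  by apply: (IHn (fun i => u (widen_ord (leqnSn n) i))
                 (fun i => c (widen_ord (leqnSn n) i))).
apply: notI_addl => //; apply: sep_ideal_sum => j; apply: sep_idealM.
by case: (hc (widen_ord (leqnSn n) j)) => h3 h4; apply: sep_ideal_gen; left.
Qed.

Definition rad_sep_pred (x : A) : bool := `[< radical I x >].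

Lemma rad_sepP x : reflect (radical I x) (x \in rad_sep_pred).
Proof. exact: asboolP. Qed.

Lemma radicalD x y : radical I x -> radical I y -> radical I (x + y).
Proof.
move=> [m Im] [n In]; exists (m + n)%N; rewrite exprDn.
apply: sep_ideal_sum => i; rewrite -mulr_natl; apply: sep_idealM.
have [ni|ni] := leqP n i.
  by rewrite -(subnK ni) exprD mulrA; apply: sep_idealM.
have mi : (m <= m + n - i)%N by rewrite leq_subRL ?leq_add2l //; lia.
by rewrite mulrC -(subnK mi) exprD mulrA; apply: sep_idealM.
Qed.

Lemma rad_sep_mul : prime_idealr_closed rad_sep_pred.
Proof.
move=> x y /rad_sepP[n Ixy]; apply/orP.
have [hx|/rad_sepP nx] := boolP (x \in rad_sep_pred); first by left.
have [hy|/rad_sepP ny] := boolP (y \in rad_sep_pred); first by right.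
exfalso; pose u := x ^+ (2 * n); pose v := y ^+ (2 * n).
have Iuv : I (u * v).
  by rewrite /u /v -exprMn mul2n -addnn exprD; apply: sep_idealM.
have upos : 0 <= ev alpha u by rewrite rmorphXn exprM exprn_ge0 // sqr_ge0.
have vpos : 0 <= ev alpha v by rewrite rmorphXn exprM exprn_ge0 // sqr_ge0.
have key s t k (z : A) : ~ radical I z -> s = z ^+ k -> 0 <= ev alpha s ->
    I (s * t) -> ev alpha s <= ev alpha t -> False.
  move=> nz sE s0 Ist st.
  have nss : ~ I (s * s) by rewrite sE -exprD => h; apply: nz; eexists; exact: h.
  have pss : pos2 (s * s).
    have [//|[h _]] := sep_ideal_sign nss.
    by move: h; rewrite rmorphM ltNge mulr_ge0.
  have [h _] := pos2_add nss pss (sep_idealN Ist).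
  by move: h; rewrite rmorphB !rmorphM subr_gt0 ltNge ler_wpM2l.
have [uv|/ltW vu] := leP (ev alpha u) (ev alpha v).
  exact: (key u v _ _ nx erefl).
by apply: (key v u _ _ ny erefl) => //; rewrite mulrC.
Qed.

Lemma rad_sep_prime : is_prime_ideal rad_sep_pred.
Proof.
split; last exact: rad_sep_mul.
split.
- by apply/rad_sepP; exists 1%N; rewrite expr1; exact: sep_ideal0.
- by apply/rad_sepP => -[n]; rewrite expr1n; exact: sep_ideal1.
move=> a x y /rad_sepP[n Ix] /rad_sepP Iy; apply/rad_sepP/radicalD => //.
by exists n; rewrite exprMn; apply: sep_idealM.
Qed.

Definition rad_sep : prime_idealr A := prime_pack rad_sep_prime.

End SeparatingIdeal.

Section StrongConnectedness.
Variable A : comNzRingType.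

Definition specializes (alpha gamma : Sper A) : Prop :=
  closure [set alpha] gamma.

Definition non_vanishing (f : A) : set (Sper A) :=
  [set gamma | ev gamma f != 0].

Definition nu_le_ideal (alpha : Sper A) (g : A) (I : set A) : Prop :=
  forall f, I f -> nu_le alpha g f.

(* The property is only meaningful for points with a common specialization. *)
Definition strong_connectedness (alpha beta : Sper A) : Prop :=
  (exists gamma, specializes alpha gamma /\ specializes beta gamma) ->
  forall (s : nat) (g : 'I_s -> A),
    (forall i, g i \notin supp alpha /\ g i \notin supp beta) ->
    (forall i, nu_le_ideal alpha (g i) (sep_ideal alpha beta) /\
               nu_le_ideal beta (g i) (sep_ideal alpha beta)) ->
    (forall i, ~ changes_sign alpha beta (g i)) ->
    connected_component (non_vanishing (\prod_(i < s) g i)) alpha beta.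

End StrongConnectedness.

(* Main.v *)
(* Write I = <alpha, beta> and p for its radical. If a is in I and g is not, then
   g + a and g - a keep the common sign of g at alpha and beta, whence |a| < |g|
   at both points. Elements of the separating ideal of alpha0, beta0 in A_p have
   the form a / s with a in I and s outside p, so their quotient by g is bounded
   by |1 / s|: the valuation condition holds for every g outside I, and so do the
   conditions on supports and signs. The two points also have a common
   specialization, since alpha and beta induce the same ordering modulo p, and
   this remains true in A_p. Strong connectedness thus connects alpha0 and beta0
   in Sper A_p, and the continuous map Sper A_p -> Sper A carries the connected
   set over to Sper A. *)
Require Import Defs.
From HB Require Import structures.
From mathcomp Require Import all_boot all_order all_algebra.
From mathcomp Require Import generic_quotient ring_quotient fraction.
From mathcomp Require Import boolp classical_sets topology.
From mathcomp Require Import finmap ring.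

Set Implicit Arguments.
Unset Strict Implicit.
Unset Printing Implicit Defensive.

Import Order.TTheory GRing.Theory Num.Theory.

Local Open Scope classical_set_scope.
Local Open Scope ring_scope.

(** * Points of the real spectrum from prime cones *)

Section PrimeCone.
Variables (A : comNzRingType) (p P : A -> bool) (hp : is_prime_ideal p).
Hypothesis PD : forall x y, P x -> P y -> P (x + y).
Hypothesis PM : forall x y, P x -> P y -> P (x * y).
Hypothesis Ptotal : forall x, P x || P (- x).
Hypothesis PpE : forall x, (x \in p) = P x && P (- x).

Let q := prime_pack hp.
Let rho (a : A) : {fraction prime_quot q} := FracField.tofrac (qproj q a).

Let rho_eq0 a : (rho a == 0) = (a \in p).
Proof. by rewrite /rho tofrac_eq0 qproj_eq0. Qed.

Let rhoM a b : rho (a * b) = rho a * rho b.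
Proof. by rewrite /rho !rmorphM. Qed.

Let rhoD a b : rho (a + b) = rho a + rho b.
Proof. by rewrite /rho !rmorphD. Qed.

Let rhoN a : rho (- a) = - rho a.
Proof. by rewrite /rho !rmorphN. Qed.

Let pM a b : a * b \in p -> (a \in p) || (b \in p).
Proof. exact: (proj2 hp). Qed.

Lemma prime_cone_sqr x : P (x * x).
Proof. by case/orP: (Ptotal x) => /[dup] /PM h /h; rewrite ?mulrNN. Qed.

Lemma prime_cone_mod x y : P x -> y - x \in p -> P y.
Proof. by rewrite PpE => Px /andP[/(PD Px)]; rewrite addrC subrK. Qed.

(** Otherwise [- y] is in the cone, so [y * (b * b)] and its opposite both are. The product then
    lies in [p], and primality puts [y] in [p], hence in the cone. *)
Lemma prime_cone_sqr_cancel y b : b \notin p -> P (y * (b * b)) -> P y.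
Proof.
move=> bp Pyb; case/orP: (Ptotal y) => // /PM /(_ (prime_cone_sqr b)) Nyb.
have : y * (b * b) \in p by rewrite PpE Pyb -mulNr.
case/pM/orP; first by rewrite PpE => /andP[].
by case/pM/orP => h; rewrite h in bp.
Qed.

(* [a / b] is nonnegative iff [a * b = (a / b) * b ^+ 2] lies in the cone. *)
Definition frac_nonneg (z : {fraction prime_quot q}) : bool :=
  `[< exists a b, [/\ b \notin p, z * rho b = rho a & P (a * b)] >].

Lemma frac_repr (z : {fraction prime_quot q}) :
  exists a b, b \notin p /\ z * rho b = rho a.
Proof.
have [n [d [d0 ->]]] := fracP z.
have [a an] := qproj_surj n; have [b bd] := qproj_surj d.
have bp : b \notin p by rewrite -rho_eq0 /rho bd tofrac_eq0.
by exists a, b; split => //; rewrite -an -bd divfK // rho_eq0.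
Qed.

(** Nonnegativity may be tested on any representative: if [a / b = a' / b'], then [a * b * b'^2] and
    [a' * b' * b^2] agree modulo [p], and the square [b'^2] cancels. *)
Lemma frac_nonnegE z a b : b \notin p -> z * rho b = rho a ->
  frac_nonneg z = P (a * b).
Proof.
move=> bp e; apply/asboolP/idP => [[a' [b' [bp' e' Pab]]]|Pab]; last first.
  by exists a, b.
apply: (prime_cone_sqr_cancel bp').
apply: (prime_cone_mod (PM Pab (prime_cone_sqr b))).
rewrite -rho_eq0 rhoD rhoN !rhoM -e -e' subr_eq0; apply/eqP; ring.
Qed.

Lemma frac_nonnegD x y : frac_nonneg x -> frac_nonneg y -> frac_nonneg (x + y).
Proof.
have [a [b [bp e]]] := frac_repr x; have [c [d [dp e']]] := frac_repr y.
have bdp : b * d \notin p.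
  by apply/negP => /pM; rewrite (negPf bp) (negPf dp).
rewrite (frac_nonnegE bp e) (frac_nonnegE dp e') => h h'.
rewrite (@frac_nonnegE _ (a * d + c * b) _ bdp); last first.
  rewrite rhoD !rhoM -e -e'; ring.
have -> : (a * d + c * b) * (b * d) = a * b * (d * d) + c * d * (b * b) by ring.
by apply: PD; apply: PM => //; exact: prime_cone_sqr.
Qed.

Lemma frac_nonnegM x y : frac_nonneg x -> frac_nonneg y -> frac_nonneg (x * y).
Proof.
have [a [b [bp e]]] := frac_repr x; have [c [d [dp e']]] := frac_repr y.
have bdp : b * d \notin p.
  by apply/negP => /pM; rewrite (negPf bp) (negPf dp).
rewrite (frac_nonnegE bp e) (frac_nonnegE dp e') => h h'.
rewrite (@frac_nonnegE _ (a * c) _ bdp); last by rewrite !rhoM -e -e'; ring.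
by rewrite mulrACA; apply: PM.
Qed.

Lemma frac_nonneg_total x : frac_nonneg x || frac_nonneg (- x).
Proof.
have [a [b [bp e]]] := frac_repr x.
rewrite (frac_nonnegE bp e) (@frac_nonnegE _ (- a) _ bp) ?mulNr //.
by rewrite e rhoN.
Qed.

Lemma frac_nonneg_anti x : frac_nonneg x -> frac_nonneg (- x) -> x = 0.
Proof.
have [a [b [bp e]]] := frac_repr x.
rewrite (frac_nonnegE bp e) (@frac_nonnegE _ (- a) _ bp); last first.
  by rewrite mulNr e rhoN.
rewrite mulNr => h h'; have /pM : a * b \in p by rewrite PpE h.
rewrite (negPf bp) orbF -rho_eq0 -e mulf_eq0 rho_eq0 (negPf bp) orbF.
by move/eqP.
Qed.

Let cone_le (x y : {fraction prime_quot q}) : bool := frac_nonneg (y - x).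

Let cone_total : total cone_le.
Proof. by move=> x y; rewrite /cone_le -[x - y]opprB frac_nonneg_total. Qed.

Let cone_refl : reflexive cone_le.
Proof. by move=> x; have := cone_total x x; rewrite orbb. Qed.

Let cone_anti : antisymmetric cone_le.
Proof.
move=> x y /andP[h h']; apply/esym/eqP; rewrite -subr_eq0; apply/eqP.
by apply: frac_nonneg_anti => //; rewrite opprB.
Qed.

Let cone_trans : transitive cone_le.
Proof.
by move=> y x z h h'; have := frac_nonnegD h h'; rewrite addrC subrKA.
Qed.

Let cone_add x y z : cone_le x y -> cone_le (x + z) (y + z).
Proof. by rewrite /cone_le opprD addrACA subrr addr0. Qed.

Let cone_mul x y : cone_le 0 x -> cone_le 0 y -> cone_le 0 (x * y).
Proof. by rewrite /cone_le !subr0; exact: frac_nonnegM. Qed.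

Definition cone_point : Sper A :=
  @MkSper A p hp (FieldOrder cone_refl cone_anti cone_trans cone_total
                    cone_add cone_mul).

Lemma cone_point_ge0 f : (0 <= ev cone_point f) = P f.
Proof.
have p1 : 1 \notin p by case: hp => -[].
rewrite -[LHS]/(frac_nonneg (rho f - 0)) (@frac_nonnegE _ f 1 p1) ?mulr1 //.
by rewrite subr0 -rhoM mulr1.
Qed.

End PrimeCone.

(** * The ordering modulo the radical of the separating ideal *)

Section CommonSpecialization.
Variables (A : comNzRingType) (alpha beta : Sper A).
Hypothesis Iproper : sep_ideal alpha beta <> setT.

Local Notation I := (sep_ideal alpha beta).
Local Notation r := (rad_sep_pred alpha beta).

Lemma sep_ideal_radical x : I x -> radical I x.
Proof. by exists 1%N. Qed.

(* If [y^n] lies in [I] and [x + y < 0 < x] at both points, then [0 < x < -y],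
   so [x^n - (-y)^n] is negative, although it is [x^n] up to an element of [I]. *)
Lemma pos2_add_radical x y :
  ~ radical I x -> pos2 alpha beta x -> radical I y -> pos2 alpha beta (x + y).
Proof.
move=> nx [xa xb] ry.
have nI : ~ I (x + y).
  (* Otherwise [x = (x + y) - y] would be in the radical. *)
  move=> /sep_ideal_radical rxy; apply: nx; rewrite -[x](addrK y).
  apply: radicalD rxy _; case: ry => n h; exists n.
  by rewrite exprNn; apply: sep_idealM.
have [//|[]] := sep_ideal_sign nI.
rewrite !rmorphD -!ltrBrDr !sub0r => la lb; case: ry => n Iyn.
have nIxn : ~ I (x ^+ n) by move=> h; apply: nx; exists n.
have pxn : pos2 alpha beta (x ^+ n) by split; rewrite rmorphXn exprn_gt0.
have [] := pos2_add Iproper nIxn pxn (sep_idealN (sep_idealM ((-1) ^+ n) Iyn)).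
rewrite -exprNn rmorphB subr_gt0 !rmorphXn rmorphN ltNge => /negP[].
by rewrite lerXn2r ?nnegrE ?(ltW xa) ?(ltW la) // (le_trans (ltW xa) (ltW la)).
Qed.

(* Modulo [rad_sep], both points induce the same ordering; this is its cone. *)
Definition sep_cone (x : A) : bool :=
  `[< radical I x \/ pos2 alpha beta x >].

Lemma sep_cone_total x : sep_cone x || sep_cone (- x).
Proof.
have [Ix|nIx] := pselect (I x).
  by apply/orP; left; apply/asboolP; left; apply: sep_ideal_radical.
apply/orP; have [h|[ha hb]] := sep_ideal_sign nIx.
  by left; apply/asboolP; right.
by right; apply/asboolP; right; split; rewrite rmorphN oppr_gt0.
Qed.

Lemma sep_coneD x y : sep_cone x -> sep_cone y -> sep_cone (x + y).
Proof.
move=> /asboolP hx /asboolP hy; apply/asboolP.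
have [rx|nx] := pselect (radical I x); have [ry|ny] := pselect (radical I y).
- by left; exact: radicalD.
- by right; rewrite addrC; apply: pos2_add_radical => //; case: hy.
- by right; apply: pos2_add_radical => //; case: hx.
case: hx hy => // -[xa xb] [] // [ya yb].
by right; split; rewrite rmorphD addr_gt0.
Qed.

Lemma radicalM x y : radical I y -> radical I (x * y).
Proof. by move=> [n h]; exists n; rewrite exprMn; apply: sep_idealM. Qed.

Lemma sep_coneM x y : sep_cone x -> sep_cone y -> sep_cone (x * y).
Proof.
move=> /asboolP[rx|[xa xb]] /asboolP hy; apply/asboolP.
  by left; rewrite mulrC; apply: radicalM.
case: hy => [ry|[ya yb]]; first by left; apply: radicalM.
by right; split; rewrite rmorphM mulr_gt0.
Qed.

Lemma rad_sep_coneE x : (x \in r) = sep_cone x && sep_cone (- x).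
Proof.
apply/rad_sepP/andP => [rx|[/asboolP[//|[xa _]] /asboolP[|[]]]].
- split; apply/asboolP; left => //.
  by rewrite -mulN1r; apply: radicalM.
- by rewrite -mulN1r => /(radicalM (-1)); rewrite mulrA mulrNN !mul1r.
- by rewrite rmorphN oppr_gt0 ltNge (ltW xa).
Qed.

Definition sep_point : Sper A :=
  cone_point (rad_sep_prime Iproper) sep_coneD sep_coneM sep_cone_total
    rad_sep_coneE.

(** By contraposition: if [f] is in the radical, or has the common sign -1 at both points, then
    [- f] lies in the cone. This is what makes [sep_point] a specialization of both points. *)
Lemma sep_point_pos f : 0 < ev sep_point f -> pos2 alpha beta f.
Proof.
rewrite ltNge -oppr_ge0 -rmorphN cone_point_ge0 => /asboolP nP.
have [rf|nf] := pselect (radical I f).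
  by case: nP; left; rewrite -mulN1r; apply: radicalM.
have [//|[fa fb]] := @sep_ideal_sign _ alpha beta f
  (fun h => nf (sep_ideal_radical h)).
by case: nP; right; split; rewrite rmorphN oppr_gt0.
Qed.

End CommonSpecialization.

(** * Basic open sets and specialization *)

Section SpectralTopology.
Variable A : comNzRingType.

Lemma open_sper_basisP (U : set (Sper A)) (x : Sper A) :
  open U -> U x -> exists F : {fset set (Sper A)},
    [/\ {subset F <= @spectral_subbase A}, (\bigcap_(i in [set` F]) i) x
      & \bigcap_(i in [set` F]) i `<=` U].
Proof.
move=> [D sD <-] [V DV Vx]; have [F sF VE] := sD _ DV.
by exists F; rewrite VE; split => // y Vy; exists V.
Qed.

Lemma open_sper_pos (f : A) : open [set gamma : Sper A | 0 < ev gamma f].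
Proof.
exists [set [set gamma : Sper A | 0 < ev gamma f]].
  by move=> _ ->; apply: finI_from1; exists f.
by rewrite bigcup_set1.
Qed.

(** Every subbasic open set around [gamma] contains [alpha]; hence so do their finite intersections,
    and so every neighbourhood of [gamma]. *)
Lemma specializesP (alpha gamma : Sper A) :
  (forall f, 0 < ev gamma f -> 0 < ev alpha f) -> specializes alpha gamma.
Proof.
move=> h U; rewrite nbhsE => -[V [oV Vg] VU]; exists alpha; split=> //.
have [F [sF Fg FV]] := open_sper_basisP oV Vg.
apply/VU/FV => S FS; have := Fg _ FS.
have /set_mem[f _ <-] := sF _ FS; exact: h.
Qed.

End SpectralTopology.

(** * Signs and connectedness under the induced map of real spectra *)

Section SperMapTheory.
Variables (A B : comNzRingType) (phi : {rmorphism A -> B}).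

(** The order of the image point is pulled back along the embedding of residue fields, which sends
    the class of [f] to that of [phi f]. *)
Lemma ev_Sper_map_ge0 (gamma : Sper B) (f : A) :
  (0 <= ev (Sper_map phi gamma) f) = (0 <= ev gamma (phi f)).
Proof.
pose q := supp_ideal gamma.
have tofrac_map : frac_map (quot_map (q := q))
    (FracField.tofrac (qproj (preim_ideal phi q) f)) =
    FracField.tofrac (qproj q (phi f)).
  have := frac_mapE (@quot_map_inj _ _ phi q) (qproj _ f) (oner_neq0 _).
  by rewrite !rmorph1 !divr1 /= quot_mapE.
rewrite -[LHS]/(fo_le (sper_order gamma) (frac_map (quot_map (q := q)) 0)
  (frac_map (quot_map (q := q))
    (FracField.tofrac (qproj (preim_ideal phi q) f)))).
by rewrite tofrac_map (frac_map0 (@quot_map_inj _ _ phi q)).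
Qed.

Variables (gamma : Sper B) (alpha : Sper A).
Hypothesis alphaE : Sper_map phi gamma = alpha.

Lemma ev_map_ge0 f : (0 <= ev alpha f) = (0 <= ev gamma (phi f)).
Proof. by rewrite -alphaE ev_Sper_map_ge0. Qed.

Lemma ev_map_le0 f : (ev alpha f <= 0) = (ev gamma (phi f) <= 0).
Proof. by rewrite -!oppr_ge0 -!rmorphN ev_map_ge0. Qed.

Lemma ev_map_gt0 f : (0 < ev alpha f) = (0 < ev gamma (phi f)).
Proof. by rewrite !ltNge ev_map_le0. Qed.

Lemma ev_map_eq0 f : (ev alpha f == 0) = (ev gamma (phi f) == 0).
Proof. by rewrite !eq_le ev_map_ge0 ev_map_le0. Qed.

Lemma ev_map_lt_norm f g : (`|ev alpha f| < `|ev alpha g|) =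
  (`|ev gamma (phi f)| < `|ev gamma (phi g)|).
Proof.
(* The two sides live in different fields and only signs of ring elements transfer, so the
   comparison becomes the sign of [v ^+ 2 - u ^+ 2]. *)
have lt_norm (C : comNzRingType) (x : Sper C) (u v : C) :
    (`|ev x u| < `|ev x v|) = (0 < ev x (v ^+ 2 - u ^+ 2)).
  rewrite rmorphB !rmorphXn subr_gt0.
  by rewrite -(real_normK (num_real (ev x u))) -(real_normK (num_real (ev x v)))
    ltr_sqr ?nnegrE.
by rewrite !lt_norm ev_map_gt0 rmorphB !rmorphXn.
Qed.

End SperMapTheory.

Lemma Sper_map_continuous (A B : comNzRingType) (phi : {rmorphism A -> B}) :
  continuous (Sper_map phi).
Proof.
move=> x U /=; rewrite nbhsE => -[V [oV Vx] VU].
have [F [sF Fg FV]] := open_sper_basisP oV Vx.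
(* A finite intersection reduces continuity to subbasic sets. *)
suff : nbhs x (\bigcap_(S in [set` F]) (Sper_map phi @^-1` S)).
  by apply: filterS => y h; apply/VU/FV => S FS; exact: h.
apply: filter_bigI => S FS; have /set_mem[f _ Sf] := sF _ FS.
have Sx := Fg _ FS; move: Sx; rewrite -Sf /= => Sx; apply: open_nbhs_nbhs; split => //.
have -> : Sper_map phi @^-1` [set gamma | 0 < ev gamma f] =
    [set gamma | 0 < ev gamma (phi f)].
  by apply/funext => y; rewrite /= (ev_map_gt0 (erefl (Sper_map phi y))).
exact: open_sper_pos.
Qed.

Lemma connected_component_Sper_map (A B : comNzRingType)
    (phi : {rmorphism A -> B}) (f : A) (x y : Sper B) :
  connected_component (non_vanishing (phi f)) x y ->
  connected_component (non_vanishing f) (Sper_map phi x) (Sper_map phi y).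
Proof.
move=> [C [Cx sC cC] Cy]; exists (Sper_map phi @` C); last by exists y.
split; first by exists x.
  move=> _ [z /sC zf <-]; rewrite /non_vanishing /=.
  by rewrite (ev_map_eq0 (erefl (Sper_map phi z))).
apply: connected_continuous_connected => //.
exact/continuous_subspaceT/Sper_map_continuous.
Qed.

(** * Common specialization and valuation bounds *)

Lemma common_specialization (A : comNzRingType) (alpha beta : Sper A) :
  sep_ideal alpha beta <> setT ->
  exists gamma, specializes alpha gamma /\ specializes beta gamma.
Proof.
move=> h; exists (sep_point h); split; apply: specializesP => f.
  by case/sep_point_pos.
by case/sep_point_pos.
Qed.

Lemma nu_le_of_lt_norm (A : comNzRingType) (alpha : Sper A) (f g t a : A) :
  f = t * a -> `|ev alpha a| < `|ev alpha g| -> nu_le alpha g f.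
Proof.
move=> -> h.
have g0 : ev alpha g != 0 by rewrite -normr_gt0 (le_lt_trans _ h).
exists (ev alpha (t * a) / ev alpha g); last by rewrite divfK.
have bound : `|ev alpha (t * a) / ev alpha g| <= `|ev alpha t|.
  rewrite normrM normfV ler_pdivrMr ?normr_gt0 // rmorphM normrM.
  by rewrite ler_wpM2l // ltW.
(* The bound must come from [A[alpha]], so [|t|] is realized as [t] or [- t]. *)
have [t0|t0] := leP 0 (ev alpha t).
  by exists (qproj _ t); rewrite -[quot_incl _]/(ev alpha t) -(ger0_norm t0).
exists (qproj _ (- t)); rewrite -[quot_incl _]/(ev alpha (- t)).
by rewrite rmorphN -(ltr0_norm t0).
Qed.

(* [g + a] and [g - a] keep the sign of [g] at both points. *)
Lemma sep_ideal_lt_norm (A : comNzRingType) (alpha beta : Sper A) (a g : A) :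
  sep_ideal alpha beta <> setT ->
  sep_ideal alpha beta a -> ~ sep_ideal alpha beta g ->
  `|ev alpha a| < `|ev alpha g| /\ `|ev beta a| < `|ev beta g|.
Proof.
move=> Ip Ia.
wlog pg : g / pos2 alpha beta g.
  move=> h nIg; have [/h//|[ga gb]] := sep_ideal_sign nIg; first exact.
  rewrite -(normrN (ev alpha g)) -(normrN (ev beta g)) -!rmorphN; apply: h.
    by split; rewrite rmorphN oppr_gt0.
  by move=> /sep_idealN; rewrite opprK.
have lt_norm (K : realDomainType) (x y : K) :
    0 < y -> 0 < y + x -> 0 < y - x -> `|x| < `|y|.
  move=> y0 yx; rewrite subr_gt0 => xy.
  by rewrite (gtr0_norm y0) ltr_norml xy andbT -subr_gt0 opprK addrC.
move=> nIg; case: (pg) => ga gb; have [h1 h2] := pos2_add Ip nIg pg Ia.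
have [h3 h4] := pos2_add Ip nIg pg (sep_idealN Ia).
by split; apply: lt_norm => //; rewrite -?rmorphD -?rmorphB.
Qed.

Lemma loc_frac_clear (A : comNzRingType) (p : prime_idealr A) (a s : A)
    (hs : s \notin p) :
  loc_map p s * loc_frac a hs = loc_map p a.
Proof.
rewrite -[LHS]/(loc_mul _ _) loc_mulE; apply/loc_fracP; exists 1.
  exact: prime_one_notin.
by rewrite mulr1 mul1r mulrC mul1r subrr.
Qed.

(** * The separating ideal in the localization *)

Section LocalizedSeparatingIdeal.
Variables (A : comNzRingType) (alpha beta : Sper A).
Hypothesis Iproper : sep_ideal alpha beta <> setT.
Let p := rad_sep Iproper.
Variables alpha0 beta0 : Sper (localization p).
Hypothesis alpha0E : Sper_map (loc_map p) alpha0 = alpha.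
Hypothesis beta0E : Sper_map (loc_map p) beta0 = beta.

Local Notation I := (sep_ideal alpha beta).
Local Notation I0 := (sep_ideal alpha0 beta0).

Lemma sep_ideal_locP (x : localization p) :
  I0 x -> exists s a, [/\ s \notin p, I a & loc_map p s * x = loc_map p a].
Proof.
move=> [n [u [c [hc ->]]]].
apply: (big_ind (fun x => exists s a,
  [/\ s \notin p, I a & loc_map p s * x = loc_map p a])) => [|x1 x2 [s1 [a1 [h1 I1 e1]]] [s2 [a2 [h2 I2 e2]]]|i _].
- exists 1, 0; split; [exact: prime_one_notin|exact: sep_ideal0|].
  by rewrite mulr0 rmorph0.
- exists (s1 * s2), (s2 * a1 + s1 * a2); split.
  + exact: prime_mul_notin.
  + by apply: sep_idealD; apply: sep_idealM.
  + rewrite (rmorphD (loc_map p)) !(rmorphM (loc_map p)) /= -e1 -e2. ring.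
have [b [t [ht uE]]] := loc_frac_surj (u i).
have [a [s [hs cE]]] := loc_frac_surj (c i).
(* For a generator [c i = a / s], the element [s * a] maps to [s^2 * c i]. Clearing by a square
   keeps the signs, so [s * a] is a generator of [I]. *)
exists (t * (s * s)), (b * (s * a)); split.
- by do 2?apply: prime_mul_notin.
- apply/sep_idealM/sep_ideal_gen; left; have [ha hb] := hc i.
  rewrite (ev_map_ge0 alpha0E) (ev_map_le0 beta0E).
  rewrite !(rmorphM (loc_map p)) /= -(loc_frac_clear a hs) -cE mulrA.
  have sqr (x0 : Sper (localization p)) (z : localization p) : 0 <= ev x0 (z * z).
    by rewrite rmorphM -expr2 sqr_ge0.
  split; first by rewrite rmorphM (mulr_ge0 (sqr _ _) ha).
  by rewrite rmorphM (mulr_ge0_le0 (sqr _ _) hb).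
rewrite !(rmorphM (loc_map p)) /= -(loc_frac_clear a hs) -(loc_frac_clear b ht).
rewrite -uE -cE; ring.
Qed.

(** If 1 were in [I0], clearing denominators would give [u * s = u * a] in [I] with [u * s] outside
    [p], although [p] contains [I]. *)
Lemma sep_ideal_loc_proper : I0 <> setT.
Proof.
move=> h; have : I0 1 by rewrite h.
move=> /sep_ideal_locP[s [a [hs Ia]]]; rewrite mulr1 => /loc_fracP[u hu].
rewrite !mulr1 mulrBr => /eqP; rewrite subr_eq0 => /eqP e.
have : u * s \notin p by exact: prime_mul_notin.
move=> /rad_sepP[]; exists 1%N; rewrite expr1 e; exact: sep_idealM.
Qed.

Lemma nu_le_loc (g : A) : ~ I g ->
  nu_le_ideal alpha0 (loc_map p g) I0 /\ nu_le_ideal beta0 (loc_map p g) I0.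
Proof.
move=> nIg; split=> f /sep_ideal_locP[s [a [hs Ia e]]].
all: have fE : f = loc_frac 1 hs * loc_map p a
  by rewrite -e mulrA [_ * loc_map p s]mulrC loc_frac_clear rmorph1 mul1r.
all: have [la lb] := sep_ideal_lt_norm Iproper Ia nIg.
all: apply: (nu_le_of_lt_norm fE).
  by rewrite -(ev_map_lt_norm alpha0E).
by rewrite -(ev_map_lt_norm beta0E).
Qed.

End LocalizedSeparatingIdeal.

Theorem theorem2p2 (A : comNzRingType) (alpha beta : Sper A)
    (Iproper : sep_ideal alpha beta <> setT)
    (alpha0 beta0 : Sper (localization (rad_sep Iproper)))
    (alpha0E : Sper_map (loc_map (rad_sep Iproper)) alpha0 = alpha)
    (beta0E : Sper_map (loc_map (rad_sep Iproper)) beta0 = beta) :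
  strong_connectedness alpha0 beta0 ->
  forall (s : nat) (g : 'I_s -> A),
    (forall i, ~ sep_ideal alpha beta (g i)) ->
    connected_component (non_vanishing (\prod_(i < s) g i)) alpha beta.
Proof.
move=> sc s g nIg; pose phi := loc_map (rad_sep Iproper).
suff : connected_component (non_vanishing (phi (\prod_(i < s) g i))) alpha0 beta0.
  by move=> /connected_component_Sper_map; rewrite alpha0E beta0E.
(* Signs at [alpha0], [beta0] are those at [alpha], [beta], so a sign change would put [g i] in the
   separating ideal. *)
have nsign i : ~ changes_sign alpha0 beta0 (phi (g i)).
  move=> h; apply/(nIg i)/sep_ideal_gen; rewrite /changes_sign.
  rewrite (ev_map_ge0 alpha0E (g i)) (ev_map_le0 alpha0E (g i)).
  by rewrite (ev_map_ge0 beta0E (g i)) (ev_map_le0 beta0E (g i)).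
rewrite /phi (rmorph_prod (loc_map _)); apply: sc => // [|i|i].
- exact/common_specialization/(sep_ideal_loc_proper alpha0E beta0E).
(* Both supports lie in the separating ideal, which [g i] avoids. *)
- have [sa sb] := sep_ideal_supp alpha beta.
  rewrite -!ev_eq0 -(ev_map_eq0 alpha0E (g i)) -(ev_map_eq0 beta0E (g i)) !ev_eq0.
  by split; apply/negP; [move=> /sa/nIg|move=> /sb/nIg].
- exact: (nu_le_loc alpha0E beta0E).
Qed.
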